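(* Let $p$ be an odd prime. The solutions in non-negative integers $x,y,z$ of the Diophantine equation $$16^{x}+p^{y}=z^{2}$$ are given in the following two cases: Case 1. For $p=3$: $(x,y,z)=(1,2,5)$. Case 2. For $p=1+2^{2k+1}$, where $k$ is a non-negative integer: $(x,y,z)=(k,1,2^{2k}+1)$. *)

(* Defs.v *)
From mathcomp Require Import all_boot.

(* Main.v *)
Require Import Defs.
From mathcomp Require Import all_boot.
From mathcomp Require Import zify.

(** Write the equation as [(z - 4^x)(z + 4^x) = p^y]. The two factors are powers
    of [p] whose difference is prime to [p], so the smaller one is [1] and
    [p^y = 2 * 4^x + 1]. The right-hand side is divisible by [3]; for [y = 1] this
    is the family of Case 2, and otherwise [p = 3]. If [y >= 2] then [x >= 1], so
    reduction modulo [8] makes [y = 2w] even, and [(3^w - 1)(3^w + 1)] is a power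
    of [2], which forces [3^w = 3]. *)

(** Both factors are powers of [p]; if [a > 1], then [p] divides both, hence also their difference
    [d]. *)
Lemma mul_shift_eq_prime_pow (p d a n : nat) :
  prime p -> coprime p d -> a * (a + d) = p ^ n -> a = 1.
Proof.
move=> p_pr cop_pd eq_a.
have /(dvdn_pfactor _ _ p_pr) [[|i] _ def_a]: a %| p ^ n by rewrite -eq_a dvdn_mulr.
  by rewrite def_a.
have p_dv_a : p %| a by rewrite def_a expnS dvdn_mulr.
have a_gt1 : 1 < a by rewrite def_a -[1](exp1n i.+1) ltn_exp2r // prime_gt1.
have /(dvdn_pfactor _ _ p_pr) [[|j] _ def_ad]: a + d %| p ^ n by rewrite -eq_a dvdn_mull.
  by lia.
have: p %| a + d by rewrite def_ad expnS dvdn_mulr.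
by rewrite dvdn_addr // => p_dv_d; move: cop_pd; rewrite prime_coprime // p_dv_d.
Qed.

Lemma three_dvd_double_pow4_succ (x : nat) : 3 %| 2 * 4 ^ x + 1.
Proof. by elim: x => [//|x IHx]; rewrite expnS; lia. Qed.

Lemma pow9_mod8 (w : nat) : 9 ^ w = 1 %[mod 8].
Proof. by rewrite -modnXm exp1n. Qed.

Lemma pow3_eq_double_pow4_succ (x y : nat) :
  3 ^ y = 2 * 4 ^ x + 1 -> (x = 0 /\ y = 1) \/ (x = 1 /\ y = 2).
Proof.
case: x => [|x] eq_y.
  by left; split=> //; apply: (@expnI 3) => //; rewrite eq_y.
right.
have y_eq := odd_double_half y; set w := y./2 in y_eq.
have pow_y : 3 ^ y = 3 ^ odd y * 9 ^ w.
  by rewrite -[in LHS]y_eq expnD -mul2n expnM.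
have mod9 := pow9_mod8 w.
(* Modulo 8, an odd [y] would give [3 * 9 ^ w = 3], whereas [2 * 4 ^ x.+1 + 1 = 1]. *)
have y_even : odd y = false.
  by case: (odd y) pow_y => //=; rewrite expnS in eq_y *; lia.
have sq_y : 3 ^ y = 3 ^ w * 3 ^ w by rewrite -expnD -[in LHS]y_eq y_even addnn.
have odd3 : odd (3 ^ w) by rewrite oddX orbT.
have [c def_c] : exists c, 3 ^ w = 2 * c + 1.
  by exists (3 ^ w)./2; rewrite mul2n addn1 -[LHS]odd_double_half odd3.
(* Squaring [2 * c + 1] turns the equation into [c * (c + 1) = 2 ^ (2 * x + 1)], a product of
   consecutive integers. *)
have c1 : c = 1.
  apply: (@mul_shift_eq_prime_pow 2 1 c (2 * x + 1)) => //.
  rewrite expnD expnM -[2 ^ 2]/4; rewrite expnS in eq_y.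
  by rewrite sq_y def_c in eq_y; nia.
rewrite c1 in def_c.
have w1 : w = 1 by apply: (@expnI 3) => //; rewrite def_c.
have y2 : y = 2 by rewrite -y_eq y_even w1.
split=> //; suff: x.+1 = 1 by [].
by apply: (@expnI 4) => //; rewrite y2 in eq_y; lia.
Qed.

Theorem theorem2 (p : nat) (p_prime : prime p) (p_odd : odd p) (x y z : nat) :
  16 ^ x + p ^ y = z ^ 2 <->
    (p = 3 /\ (x, y, z) = (1, 2, 5)) \/
    (exists k : nat,
        p = 1 + 2 ^ (2 * k + 1) /\ (x, y, z) = (k, 1, 2 ^ (2 * k) + 1)).
Proof.
split; last first.
  case=> [[-> [-> -> ->]] //|[k [-> [-> -> ->]]]].
  (* With [t = 4 ^ k] this is [t ^ 2 + (1 + 2 * t) = (t + 1) ^ 2]. *)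
  rewrite expn1 expnD !expnM -[16]/(4 ^ 2) -[2 ^ 2]/4 -expnM mulnC expnM.
  by nia.
rewrite -[16]/(4 ^ 2) -expnM mulnC expnM => eq_z.
have py_gt0 : 0 < p ^ y by rewrite expn_gt0 prime_gt0.
have z_gt : 4 ^ x < z by nia.
have cop : coprime p (2 * 4 ^ x).
  rewrite -[4]/(2 ^ 2) -expnM -expnS coprimeXr //.
  by rewrite prime_coprime // dvdn_prime2 //; apply: contraTneq p_odd => ->.
(* The factors [z - 4 ^ x] and [z + 4 ^ x] differ by [2 * 4 ^ x]; [z_gt] keeps the subtraction from
   truncating. *)
have eq1 : z - 4 ^ x = 1.
  by apply: (@mul_shift_eq_prime_pow p (2 * 4 ^ x) _ y) => //; nia.
have def_z : z = 4 ^ x + 1 by lia.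
have eq_py : p ^ y = 2 * 4 ^ x + 1 by rewrite def_z in eq_z; nia.
case: (eqVneq y 1) => [y1|y_neq1].
  (* Here [p = 2 * 4 ^ x + 1 = 1 + 2 ^ (2 * x + 1)], so [k] is [x]. *)
  right; exists x; rewrite y1 expn1 in eq_py.
  by rewrite y1 eq_py def_z expnD !expnM expn1 -[2 ^ 2]/4; split=> //; lia.
have p3 : p = 3.
  have: 3 %| p ^ y by rewrite eq_py three_dvd_double_pow4_succ.
  by rewrite Euclid_dvdX // dvdn_prime2 // => /andP[/eqP].
left; split=> //; rewrite p3 in eq_py.
case: (pow3_eq_double_pow4_succ _ _ eq_py) => [[_ y1]|[x1 y2]].
  by rewrite y1 in y_neq1.
by rewrite def_z x1 y2.
Qed.
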